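(* Let $n\geq 0$, $l\geq 1$, $p\geq 2$, and $q\geq 2$ be integers. Let $\mathcal{M}$ be a family (set) of Meshalkin sequences of length $p$ in $\mathbb{P}^{n-1}(q)$ such that, for each $k \in \{1,\dots,p-1\}$, the set $\mathcal{M}_k = \{ a_k : (a_1,\dots,a_p)\in\mathcal{M}\}$ contains no chain of length $l$. Then (a) $\displaystyle \sum_{a\in \mathcal{M}} \frac{1}{\left[ {n \atop r(a)} \right] q^{ s_2(r(a)) }} \leq l^{p-1}$, and (b) $|\mathcal{M}|$ is at most equal to the sum of the $l^{p-1}$ largest amongst the quantities $\left[ {n \atop \alpha} \right] q^{ s_2(\alpha) }$ for $\alpha = ( \alpha_1,\dots,\alpha_p )$ ranging over $p$-tuples of integers with all $\alpha_k \geq 0$ and $\alpha_1 + \dots + \alpha_p = n$.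
   Context: $\mathbb{P}^{n-1}(q)$ denotes a (finite) projective geometry of order $q$ and rank $n$ (dimension $n-1$): a set of points and lines such that any two distinct points lie on a unique line, every line has exactly $q+1$ points, and the Veblen–Young axiom holds. By convention it is empty if $n=0$, a single point if $n=1$, and a line of $q+1$ points if $n=2$. A flat (subspace) is a set of points containing, with any two distinct points, the whole line through them. The geometry is regarded as its lattice of flats ordered by inclusion, with $\hat 0=\varnothing$, $\hat 1$ the whole set of points, and join $\vee$ (the flat generated by the union). The rank of a flat $a$ is $r(a)=\dim a+1$ (so $r(\hat 0)=0$, points have rank $1$, lines have rank $2$, $r(\hat 1)=n$). A Meshalkin sequence of length $p$ in $\mathbb{P}^{n-1}(q)$ is a sequence $a=(a_1,\dots,a_p)$ of flats with $a_1\vee\dots\vee a_p=\hat 1$ and $r(a_1)+\dots+r(a_p)=n$. Write $r(a)=(r(a_1),\dots,r(a_p))$. A chain of length $l$ is a chain of $l+1$ distinct, pairwise comparable flats (so containing no chain of length $1$ means being an antichain). For $m \ge 0$, $m!_q=(q^m-1)(q^{m-1}-1)\cdots(q-1)$, with $0!_q=1$. For nonnegative integers $\alpha=(\alpha_1,\dots,\alpha_p)$ with sum $n$, the Gaussian multinomial coefficient is $\left[ {n \atop \alpha} \right]=\frac{n!_q}{\alpha_1!_q\cdots\alpha_p!_q}$. Also $s_2(\alpha)=\sum_{i<j}\alpha_i\alpha_j$. The ''$l^{p-1}$ largest amongst the quantities'' is understood with the quantities indexed by the tuples $\alpha$ (equal values for different $\alpha$ are counted separately); if there are fewer than $l^{p-1}$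 tuples $\alpha$, i.e. $\binom{n+p-1}{p-1}<l^{p-1}$, the sum is over all of them. *)

(* Defs.v *)
From mathcomp Require Import all_boot all_order all_algebra.
Set Implicit Arguments.
Unset Strict Implicit.
Unset Printing Implicit Defensive.
Import Order.TTheory GRing.Theory Num.Theory.

(* For q >= 1.  A line is identified with its set of points; two distinct
   lines cannot have the same points, since a line has at least two of them
   and two points lie on only one line. *)

Section Flats.
Variables (T : finType) (lines : {set {set T}}).

Definition flat (A : {set T}) : bool :=
  [forall x in A, forall y in A, forall L in lines,
    [&& x != y, x \in L & y \in L] ==> (L \subset A)].

Definition flat_span (A : {set T}) : {set T} :=
  \bigcap_(F : {set T} | flat F && (A \subset F)) F.

(* dim + 1, i.e. the least number of points generating the flat A (or, for an
   arbitrary set A of points, the flat spanned by A). *)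
Definition rank (A : {set T}) : nat :=
  #|[arg min_(B < A | flat_span B == flat_span A) #|B|]|.

End Flats.

(* The Veblen-Young axiom: if the lines xy and zw meet, so do xz and yw.
   The conventions for small n hold automatically: for n = 0 there is no
   point, for n = 1 one point (and no line), for n = 2 exactly one line. *)
Record projective_geometry (q n : nat) := ProjectiveGeometry {
  point : finType;
  lines : {set {set point}};
  line_through : forall x y : point, x != y ->
    exists! L : {set point}, [/\ L \in lines, x \in L & y \in L];
  card_line : forall L : {set point}, L \in lines -> #|L| = q.+1;
  veblen_young : forall (x y z w : point) (Lxy Lzw Lxz Lyw : {set point}),
    uniq [:: x; y; z; w] ->
    [/\ Lxy \in lines, Lzw \in lines, Lxz \in lines & Lyw \in lines] ->
    [/\ x \in Lxy, y \in Lxy, z \in Lzw & w \in Lzw] ->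
    [/\ x \in Lxz, z \in Lxz, y \in Lyw & w \in Lyw] ->
    Lxy :&: Lzw != set0 -> Lxz :&: Lyw != set0;
  rank_geometry : rank lines [set: point] = n
}.

Definition meshalkin (q n p : nat) (P : projective_geometry q n)
    (a : {ffun 'I_p -> {set point P}}) : Prop :=
  [/\ forall i, flat (lines P) (a i),
      flat_span (lines P) (\bigcup_i a i) = [set: point P]
    & (\sum_i rank (lines P) (a i))%N = n].

Definition chain (T : finType) (C : {set {set T}}) : bool :=
  [forall A in C, forall B in C, (A \subset B) || (B \subset A)].

Definition contains_chain (T : finType) (l : nat) (F : {set {set T}}) : Prop :=
  exists C : {set {set T}}, [/\ C \subset F, chain C & #|C| = l.+1].

Local Open Scope ring_scope.

Definition qfact (q m : nat) : rat := \prod_(1 <= i < m.+1) (q%:R ^+ i - 1).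

Definition gauss_multinomial (q n p : nat) (alpha : 'I_p -> nat) : rat :=
  qfact q n / \prod_(i < p) qfact q (alpha i).

Definition s2 (p : nat) (alpha : 'I_p -> nat) : nat :=
  (\sum_(i < p) \sum_(j < p | i < j) alpha i * alpha j)%N.

Definition meshalkin_weight (q n p : nat) (alpha : 'I_p -> nat) : rat :=
  gauss_multinomial q n alpha * q%:R ^+ s2 alpha.

(* Indexed by the compositions alpha of n into p parts >= 0 (each part is at
   most n, whence 'I_n.+1), so values are repeated with multiplicity. *)
Definition meshalkin_weights (q n p : nat) : seq rat :=
  [seq meshalkin_weight q n (fun i => alpha i : nat) |
    alpha : {ffun 'I_p -> 'I_n.+1} <- enum {: {ffun 'I_p -> 'I_n.+1}}
    & (\sum_i alpha i == n)%N].

Definition sum_largest (m : nat) (s : seq rat) : rat :=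
  \sum_(x <- take m (sort (fun x y : rat => y <= x) s)) x.

(* Main.v *)
Require Import Defs.
From mathcomp Require Import all_boot all_order all_algebra zify ring lra.
Import Order.TTheory GRing.Theory Num.Theory.

(** Everything follows from one double count of ordered bases, that is, of
    sequences of n points that span the geometry.

    Say that an ordered basis s is adapted to a Meshalkin sequence a if, when s
    is cut into consecutive blocks of lengths r(a_1), ..., r(a_p), the k-th block
    spans a_k.  Concatenating ordered bases of a_1, ..., a_p always gives an
    ordered basis of the whole space, because the a_k generate it and their
    ranks add up to n.  Hence a has exactly the product of the B(r(a_k)) adapted
    bases, where B(r) counts the ordered bases of a flat of rank r, and the
    quotient of this product by B(n) is the reciprocal of the weight
    [n; r(a)] q^s2(r(a)) ([num_ordered_bases_ratio]).  In other words, the summand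
    of part (a) at a is the probability that a random ordered basis is adapted
    to a, and part (a) holds because an ordered basis is adapted to at most
    l^(p-1) members of the family ([card_adapted]).  Indeed, once
    a_1, ..., a_(k-1) are known, the place where the k-th block starts is known,
    so the candidates for a_k are spans of initial segments of one fixed
    sequence.  They form a chain, of which at most l members can be in M_k; and
    the last flat is determined, since its rank is.

    The formula for B(r) rests on the fact that a flat of rank r has
    [r]_q = 1 + q + ... + q^(r-1) points.  This comes from the Veblen-Young
    axiom: for a flat F and a point x outside it, the lines joining x to the
    points of F form a flat, and two of them meet in x only, so that this flat
    has q |F| + 1 points ([card_flat_spanU]).

    For part (b), fix a rank type alpha.  An ordered basis is adapted to at most
    one Meshalkin sequence of type alpha, so the same double count bounds the
    number of members of type alpha by the weight of alpha.  Part (a) then bounds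
    the sum of the ratios number / weight, each of which is in [0, 1], by
    l^(p-1); under these constraints the total number is greatest when the ratio
    is 1 on the l^(p-1) largest weights ([weighted_sum_le_sum_largest]). *)

Set Implicit Arguments.
Unset Strict Implicit.
Unset Printing Implicit Defensive.

(** * Flats and spans *)

Section Span.
Variables (T : finType) (ls : {set {set T}}).
Local Notation span := (flat_span ls).

Lemma flatP (A : {set T}) :
  reflect (forall x y L, x \in A -> y \in A -> L \in ls ->
             x != y -> x \in L -> y \in L -> L \subset A) (flat ls A).
Proof.
apply: (iffP forall_inP) => [fA x y L xA yA Ll xy xL yL|fA x xA].
  have /forall_inP/(_ L Ll)/implyP := forall_inP (fA x xA) y yA.
  by apply; rewrite xy xL.
apply/forall_inP => y yA; apply/forall_inP => L Ll; apply/implyP => /and3P[].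
exact: fA.
Qed.

Lemma flat_span_min (A F : {set T}) : flat ls F -> A \subset F -> span A \subset F.
Proof. by move=> fF AF; apply: (bigcap_inf F); rewrite fF. Qed.

Lemma sub_flat_span (A : {set T}) : A \subset span A.
Proof. by apply/bigcapsP => F /andP[]. Qed.

Lemma flat_flat_span (A : {set T}) : flat ls (span A).
Proof.
apply/flatP => x y L xA yA Ll xy xL yL; apply/bigcapsP => F HF.
have sAF : span A \subset F by apply: bigcap_inf.
case/andP: HF => /flatP fF _.
exact: fF (subsetP sAF _ xA) (subsetP sAF _ yA) Ll xy xL yL.
Qed.

Lemma flat_span_id (F : {set T}) : flat ls F -> span F = F.
Proof.
by move=> fF; apply/eqP; rewrite eqEsubset sub_flat_span flat_span_min.
Qed.

Lemma flat_spanS (A B : {set T}) : A \subset B -> span A \subset span B.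
Proof.
move=> AB; apply: flat_span_min (flat_flat_span B) _.
exact: subset_trans AB (sub_flat_span B).
Qed.

Lemma flat_spanU (x : T) (A : {set T}) : span (x |: A) = span (x |: span A).
Proof.
apply/eqP; rewrite eqEsubset flat_spanS ?setUS ?sub_flat_span //=.
apply: flat_span_min (flat_flat_span _) _; rewrite subUset.
rewrite (subset_trans _ (sub_flat_span _)) ?subsetUl //.
by rewrite flat_spanS // subsetUr.
Qed.

End Span.

(** * The span of a flat and a point *)

Section Cone.
Variables (q n : nat) (P : projective_geometry q n).
Local Notation T := (point P).
Local Notation span := (flat_span (lines P)).

Lemma line_unique (x y : T) (L L' : {set T}) : x != y ->
  L \in lines P -> x \in L -> y \in L -> L' \in lines P -> x \in L' -> y \in L' ->
  L = L'.
Proof.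
move=> xy Ll xL yL L'l xL' yL'.
have [L0 [_ U]] := line_through xy.
by rewrite -(U L) // -(U L').
Qed.

Lemma line_exists (x y : T) : x != y ->
  exists L : {set T}, [/\ L \in lines P, x \in L & y \in L].
Proof. by case/line_through => L [? _]; exists L. Qed.

Definition collinear (x y z : T) : bool :=
  [exists L in lines P, [&& x \in L, y \in L & z \in L]].

(** For x outside F, the union of the lines that join x to points of F.  The apex is
    added separately for the sake of empty F. *)
Definition cone (x : T) (F : {set T}) : {set T} :=
  [set w | (w == x) || [exists f in F, collinear x f w]].

Lemma mem_cone (x f w : T) (F L : {set T}) : f \in F ->
  L \in lines P -> x \in L -> f \in L -> w \in L -> w \in cone x F.
Proof.
move=> fF Ll xL fL wL; rewrite inE; apply/orP; right.
by apply/exists_inP; exists f => //; apply/exists_inP; exists L => //; apply/and3P.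
Qed.

Lemma coneP (x w : T) (F : {set T}) : w \in cone x F ->
  w = x \/ exists f L, [/\ f \in F, L \in lines P, x \in L, f \in L & w \in L].
Proof.
rewrite inE => /orP[/eqP->|]; first by left.
case/exists_inP => f fF /exists_inP[L Ll /and3P[xL fL wL]].
by right; exists f, L.
Qed.

Lemma sub_cone (x : T) (F : {set T}) : x |: F \subset cone x F.
Proof.
apply/subsetP => f; rewrite in_setU1 => /orP[/eqP->|fF]; first by rewrite inE eqxx.
have [->|fx] := eqVneq f x; first by rewrite inE eqxx.
by have [L [Ll fL xL]] := line_exists fx; exact: (mem_cone fF Ll xL fL fL).
Qed.

(** If y lies on the line xf with f in F, then the lines xf and uw meet in y, so by
    Veblen-Young the lines xw and fu meet, and they do so in a point h of F: thus
    w is on the line xh.  Coincidences among these points are treated first, since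
    the axiom asks for distinct points.  This is the case of [flat_cone] where the line L meets
    F. *)
Lemma cone_line_base (x u y w : T) (F L : {set T}) :
  flat (lines P) F -> x \notin F -> u \in F -> y \in cone x F -> u != y ->
  L \in lines P -> u \in L -> y \in L -> w \in L -> w \in cone x F.
Proof.
move=> fF xF uF yC uy Ll uL yL wL.
case/coneP: yC => [eyx|[f [K [fF' Kl xK fK yK]]]].
  by rewrite -eyx in xF *; apply: mem_cone uF Ll yL uL wL.
have [eux|xu] := eqVneq x u; first by rewrite eux uF in xF.
have [exf|xf] := eqVneq x f; first by rewrite exf fF' in xF.
have [efu|fu] := eqVneq f u.
  rewrite efu in fK.
  by rewrite (line_unique uy Ll uL yL Kl fK yK) in wL; apply: mem_cone uF Kl xK fK wL.
have sC v : v \in x |: F -> v \in cone x F by apply: subsetP (sub_cone x F) v.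
have [->|wx] := eqVneq w x; first by rewrite sC ?setU11.
have [->|wf] := eqVneq w f; first by rewrite sC ?setU1r.
have [->|wu] := eqVneq w u; first by rewrite sC ?setU1r.
have [N [Nl xN wN]] : exists L : {set T}, [/\ L \in lines P, x \in L & w \in L].
  by apply: line_exists; rewrite eq_sym.
have [J [Jl fJ uJ]] := line_exists fu.
have : N :&: J != set0.
  apply: (@veblen_young _ _ P x f w u K L N J) => //.
  - by rewrite /= !inE !negb_or xf xu eq_sym wx eq_sym wf fu wu.
  - by apply/set0Pn; exists y; rewrite inE yK.
case/set0Pn => h; rewrite inE => /andP[hN hJ].
have hF : h \in F by apply: subsetP (flatP _ _ fF _ _ _ fF' uF Jl fu fJ uJ) _ hJ.
exact: mem_cone hF Nl xN hN wN.
Qed.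

(** A line that joins two points of the cone and avoids the apex meets the base:
    for y on xf and z on xg, the lines yf and zg meet in x, so by Veblen-Young the
    lines yz and fg meet.  With [cone_line_base] this shows that the cone is
    flat. *)
Lemma cone_secant (x y z : T) (F L : {set T}) :
  flat (lines P) F -> x \notin F -> y \in cone x F -> z \in cone x F -> y != z ->
  L \in lines P -> y \in L -> z \in L -> x \notin L -> exists2 u, u \in F & u \in L.
Proof.
move=> fF xF yC zC yz Ll yL zL xL.
have [eyx|yx] := eqVneq y x; first by rewrite -eyx yL in xL.
have [ezx|zx] := eqVneq z x; first by rewrite -ezx zL in xL.
case/coneP: yC => [/eqP|[f [K [fF' Kl xK fK yK]]]]; first by rewrite (negPf yx).
case/coneP: zC => [/eqP|[g [J [gF Jl xJ gJ zJ]]]]; first by rewrite (negPf zx).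
have [eyf|yf] := eqVneq y f; first by exists f; rewrite // -eyf.
have [ezg|zg] := eqVneq z g; first by exists g; rewrite // -ezg.
have KJ : K != J.
  apply: contraNneq xL => eKJ; rewrite -eKJ in zJ.
  by rewrite (line_unique yz Ll yL zL Kl yK zJ).
have nKJ v : v \in K -> v \in J -> v = x.
  move=> vK vJ; apply/eqP; apply: contraNT KJ => vx.
  by apply/eqP; apply: line_unique vx _ _ _ _ _ _.
have xf : f != x by apply: contraNneq xF => <-.
have fg : f != g by apply: contraNneq xf => efg; rewrite (nKJ f) // efg.
have [I [Il fI gI]] := line_exists fg.
have : L :&: I != set0.
  apply: (@veblen_young _ _ P y f z g K J L I) => //.
  - rewrite /= !inE !negb_or yf yz fg zg !andbT /=.
    apply/andP; split; first by apply: contraNneq yx => eyg; rewrite (nKJ y) // eyg.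
    by apply: contraNneq zx => efz; rewrite (nKJ z) // -efz.
  - by apply/set0Pn; exists x; rewrite inE xK.
case/set0Pn => u; rewrite inE => /andP[uL uI]; exists u => //.
exact: subsetP (flatP _ _ fF _ _ _ fF' gF Il fg fI gI) _ uI.
Qed.

Lemma flat_cone (x : T) (F : {set T}) :
  flat (lines P) F -> x \notin F -> flat (lines P) (cone x F).
Proof.
move=> fF xF; apply/flatP => y z L yC zC Ll yz yL zL; apply/subsetP => w wL.
have [xL|xL] := boolP (x \in L).
  wlog yx : y z yC zC yz yL zL / y != x.
    move=> W; have [eyx|] := eqVneq y x; last exact: (W y z).
    by apply: (W z y); rewrite // eq_sym // -eyx.
  case/coneP: (yC) => [/eqP|[f [K [fF' Kl xK fK yK]]]]; first by rewrite (negPf yx).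
  by rewrite (line_unique yx Ll yL xL Kl yK xK) in wL; apply: mem_cone fF' Kl xK fK wL.
have [u uF uL] := cone_secant fF xF yC zC yz Ll yL zL xL.
have [euy|uy] := eqVneq u y; last exact: cone_line_base fF xF uF yC uy Ll uL yL wL.
by rewrite -euy in yz; apply: cone_line_base fF xF uF zC yz Ll uL zL wL.
Qed.

Lemma flat_span_cone (x : T) (F : {set T}) :
  flat (lines P) F -> x \notin F -> span (x |: F) = cone x F.
Proof.
move=> fF xF; apply/eqP; rewrite eqEsubset flat_span_min ?flat_cone ?sub_cone //=.
apply/subsetP => w.
have sS v : v \in x |: F -> v \in span (x |: F).
  exact: subsetP (sub_flat_span _ _) v.
case/coneP => [->|[f [L [fF' Ll xL fL wL]]]]; first by rewrite sS ?setU11.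
have xf : x != f by apply: contraNneq xF => ->.
apply: subsetP wL; apply: (flatP _ _ (flat_flat_span _ _)) Ll xf xL fL.
  by rewrite sS ?setU11.
by rewrite sS ?setU1r.
Qed.

Lemma card_line_punctured (x f : T) : x != f -> #|[set w in [set~ x] | collinear x f w]| = q.
Proof.
move=> xf; have [L [Ll xL fL]] := line_exists xf.
rewrite -[RHS]/(q.+1.-1) -(card_line Ll) (cardsD1 x L) xL /=.
apply: eq_card => w; rewrite !inE; congr (_ && _).
apply/exists_inP/idP => [[K Kl /and3P[xK fK wK]]|wL].
  by rewrite (line_unique xf Ll xL fL Kl xK fK).
by exists L; rewrite // xL fL.
Qed.

(** Two rays of the cone share only the apex: a line xw through two points of the
    flat F would lie in F, and so would x. *)
Lemma cone_ray_unique (x w f g : T) (F : {set T}) :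
  flat (lines P) F -> x \notin F -> w != x -> f \in F -> g \in F ->
  collinear x f w -> collinear x g w -> f = g.
Proof.
move=> fF xF wx fF' gF /exists_inP[L Ll /and3P[xL fL wL]].
case/exists_inP=> K Kl /and3P[xK gK wK].
rewrite (line_unique wx Kl wK xK Ll wL xL) in gK.
apply/eqP; apply: contraNT xF => fg.
exact: subsetP (flatP _ _ fF _ _ _ fF' gF Ll fg fL gK) _ xL.
Qed.

(** The points of the cone other than x are distributed over the lines xf, one for
    each f in F, with q of them on each line. *)
Lemma card_flat_spanU (x : T) (F : {set T}) :
  flat (lines P) F -> x \notin F -> #|span (x |: F)| = (q * #|F|).+1.
Proof.
move=> fF xF; rewrite flat_span_cone // (cardsD1 x) {1}inE eqxx /= add1n; congr _.+1.
have -> : #|cone x F :\ x| = \sum_(w in [set~ x]) \sum_(f in F) (collinear x f w : nat).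
  rewrite -sum1_card [RHS](big_setID (cone x F)) /= [X in _ = _ + X]big1 ?addn0; last first.
    move=> w; rewrite !inE negb_or => /andP[/andP[_ /exists_inPn nC] _].
    by apply: big1 => f /nC/negPf->.
  apply: eq_big => [w|w]; first by rewrite !inE.
  rewrite !inE => /andP[wx]; rewrite (negPf wx) /= => /exists_inP[f fF' Cf].
  rewrite (bigD1 f) //= Cf big1 // => g /andP[gF gf].
  by case: (boolP (collinear x g w)) => // Cg; rewrite (cone_ray_unique fF xF wx gF fF' Cg Cf) eqxx in gf.
rewrite exchange_big /= mulnC -sum_nat_const; apply: eq_bigr => f fF'.
have xf : x != f by apply: contraNneq xF => ->.
rewrite -[RHS](card_line_punctured xf) -sum1_card big_mkcond [RHS]big_mkcond /=.
by apply: eq_bigr => w _; rewrite !inE; case: (w == x); case: (collinear x f w).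
Qed.

End Cone.

(** * q-integers, and the number of points of a flat *)

(** The q-integer [m]_q, which is (q^m-1)/(q-1) for q > 1. *)
Definition qint (q m : nat) : nat := \sum_(i < m) q ^ i.

Lemma qint0 (q : nat) : qint q 0 = 0.
Proof. by rewrite /qint big_ord0. Qed.

Lemma qintS (q m : nat) : qint q m.+1 = (q * qint q m).+1.
Proof.
rewrite /qint big_ord_recl expn0 add1n big_distrr /=; congr _.+1.
by apply: eq_bigr => i _; rewrite -expnS.
Qed.

Lemma leq_qint (q : nat) : 0 < q -> {mono qint q : i j / i <= j}.
Proof.
move=> q0; apply: leq_mono => i j ij.
have e : qint q j = qint q i + \sum_(i <= k < j) q ^ k.
  by rewrite /qint -!(big_mkord xpredT) (big_cat_nat (leq0n i) (ltnW ij)).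
rewrite e -[X in X < _]addn0 ltn_add2l (big_ltn ij) ltn_addr //.
by rewrite expn_gt0 q0.
Qed.

Section Rank.
Variables (q n : nat) (P : projective_geometry q n).
Hypothesis q_gt0 : 0 < q.
Local Notation T := (point P).
Local Notation span := (flat_span (lines P)).
Local Notation rk := (rank (lines P)).

Definition seq_span (s : seq T) : {set T} := span [set x in s].

Lemma flat_seq_span (s : seq T) : flat (lines P) (seq_span s).
Proof. exact: flat_flat_span. Qed.

Lemma seq_span_min (F : {set T}) (s : seq T) :
  flat (lines P) F -> [set x in s] \subset F -> seq_span s \subset F.
Proof. exact: flat_span_min. Qed.

Lemma seq_span_cons (x : T) (s : seq T) : seq_span (x :: s) = span (x |: seq_span s).
Proof. by rewrite /seq_span set_cons flat_spanU. Qed.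

Lemma card_seq_span_nil : #|seq_span [::]| = 0.
Proof.
apply/eqP; rewrite cards_eq0 /seq_span set_nil flat_span_id //.
by apply/flatP => x y L; rewrite inE.
Qed.

Lemma seq_span_cons_in (x : T) (s : seq T) :
  x \in seq_span s -> seq_span (x :: s) = seq_span s.
Proof.
move=> xs; rewrite seq_span_cons; have /setUidPr -> : [set x] \subset seq_span s.
  by rewrite sub1set.
exact: flat_span_id (flat_seq_span s).
Qed.

Lemma card_seq_span_cons (x : T) (s : seq T) :
  x \notin seq_span s -> #|seq_span (x :: s)| = (q * #|seq_span s|).+1.
Proof. by move=> xs; rewrite seq_span_cons card_flat_spanU // flat_seq_span. Qed.

(** Keeping only the points outside the span of those that come after them does not
    change the span, and each point that is kept turns a span of [m]_q points into
    one of [m+1]_q points. *)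
Lemma seq_span_basis (s : seq T) :
  exists t, [/\ size t <= size s, seq_span t = seq_span s
              & #|seq_span t| = qint q (size t)].
Proof.
elim: s => [|x s [t [st et ct]]].
  by exists [::]; split; rewrite // card_seq_span_nil qint0.
have [xs|xs] := boolP (x \in seq_span s).
  by exists t; split; rewrite //= ?(leqW st) // seq_span_cons_in.
exists (x :: t); split => //; first by rewrite !seq_span_cons et.
by rewrite card_seq_span_cons et // -et ct qintS.
Qed.

Lemma card_seq_span_le (s : seq T) : #|seq_span s| <= qint q (size s).
Proof. by have [t [st <- ->]] := seq_span_basis s; rewrite leq_qint. Qed.

(** By minimality, a smallest generating set of F loses no point in
    [seq_span_basis]. *)
Lemma card_flat (F : {set T}) : flat (lines P) F -> #|F| = qint q (rk F).
Proof.
move=> fF; rewrite /rank; case: arg_minnP => // B /eqP eB minB.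
have spB : seq_span (enum B) = F.
  by rewrite /seq_span set_enum eB flat_span_id.
have [t [st et ct]] := seq_span_basis (enum B).
rewrite -spB -et ct; congr (qint q _); apply/eqP; rewrite eqn_leq.
rewrite [X in _ <= X]cardE st /=.
rewrite (leq_trans (minB [set x in t] _)) ?(leq_trans (card_size _)) //.
  by rewrite -/(seq_span t) et spB flat_span_id.
by rewrite cardsE card_size.
Qed.

(** Independence of a sequence can be read off from the cardinality of its span: a
    dependent sequence of k + 1 points has a span of at most [k]_q points. *)
Lemma card_seq_span_consE (x : T) (s : seq T) (k : nat) : size s = k ->
  (#|seq_span (x :: s)| == qint q k.+1)
    = (x \notin seq_span s) && (#|seq_span s| == qint q k).
Proof.
move=> sk; have [xs|xs] /= := boolP (x \in seq_span s).
  rewrite seq_span_cons_in //; apply: contraFF (ltnn k) => /eqP e.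
  by rewrite -(leq_qint q_gt0) -e -sk card_seq_span_le.
by rewrite card_seq_span_cons // qintS eqSS eqn_pmul2l.
Qed.

End Rank.

(** * Sums over sequences of points *)

Section SeqSum.
Variable T : finType.

(** Recursion on k, rather than a sum
    over a type of tuples, makes it possible to cut sequences at a place r in
    [seq_sum_cat] without any transport between types. *)
Fixpoint seq_sum (k : nat) (f : seq T -> nat) : nat :=
  if k is k'.+1 then \sum_(x : T) seq_sum k' (fun s => f (x :: s)) else f [::].

Lemma eq_seq_sum (k : nat) (f g : seq T -> nat) :
  (forall s, size s = k -> f s = g s) -> seq_sum k f = seq_sum k g.
Proof.
elim: k f g => [|k IH] f g fg /=; first exact: fg.
by apply: eq_bigr => x _; apply: IH => s sk; apply: fg; rewrite /= sk.
Qed.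

Lemma leq_seq_sum (k : nat) (f g : seq T -> nat) :
  (forall s, size s = k -> f s <= g s) -> seq_sum k f <= seq_sum k g.
Proof.
elim: k f g => [|k IH] f g fg /=; first exact: fg.
by apply: leq_sum => x _; apply: IH => s sk; apply: fg; rewrite /= sk.
Qed.

Lemma seq_sum_exchange (I : finType) (A : pred I) (k : nat) (f : I -> seq T -> nat) :
  seq_sum k (fun s => \sum_(i | A i) f i s) = \sum_(i | A i) seq_sum k (f i).
Proof.
elim: k f => [|k IH] f //=.
by rewrite exchange_big /=; apply: eq_bigr => x _; rewrite IH.
Qed.

Lemma seq_sum_mull (k : nat) (f : seq T -> nat) (c : nat) :
  seq_sum k (fun s => c * f s) = c * seq_sum k f.
Proof.
elim: k f => [|k IH] f //=.
by rewrite big_distrr; apply: eq_bigr => x _; rewrite IH.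
Qed.

Lemma seq_sum_cons (k : nat) (f : seq T -> nat) :
  seq_sum k.+1 f = seq_sum k (fun s => \sum_(x : T) f (x :: s)).
Proof. by rewrite seq_sum_exchange. Qed.

Lemma seq_sum_cat (r m : nat) (f g : seq T -> nat) :
  seq_sum (r + m) (fun s => f (take r s) * g (drop r s)) = seq_sum r f * seq_sum m g.
Proof.
elim: r f => [|r IH] f /=.
  rewrite add0n -seq_sum_mull; apply: eq_seq_sum => s _; by rewrite take0 drop0.
by rewrite big_distrl; apply: eq_bigr => x _; apply: (IH (fun s => f (x :: s))).
Qed.

End SeqSum.

(** * Counting ordered bases *)

Definition num_ordered_bases (q r : nat) : nat := \prod_(i < r) (qint q r - qint q i).

Section Bases.
Variables (q n : nat) (P : projective_geometry q n).
Hypothesis q_gt0 : 0 < q.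
Local Notation T := (point P).
Local Notation span := (flat_span (lines P)).
Local Notation rk := (rank (lines P)).

(** An independent sequence of k points of F extends to the left by exactly the
    points of F outside its span, and there are [r]_q - [k]_q of these, where r is
    the rank of F. *)
Lemma seq_sum_independent (F : {set T}) (k : nat) : flat (lines P) F ->
  seq_sum k (fun s => ([set x in s] \subset F) && (#|seq_span s| == qint q k))
    = \prod_(i < k) (qint q (rk F) - qint q i).
Proof.
move=> fF; elim: k => [|k IH].
  by rewrite /= big_ord0 card_seq_span_nil qint0 set_nil sub0set.
rewrite big_ord_recr [RHS]/= -IH mulnC -seq_sum_mull seq_sum_cons.
apply: eq_seq_sum => s sk.
transitivity (\sum_(x in F :\: seq_span s)
     (([set x in s] \subset F) && (#|seq_span s| == qint q k) : nat)).
  rewrite [RHS]big_mkcond; apply: eq_bigr => x _.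
  rewrite card_seq_span_consE // set_cons subUset sub1set !inE.
  by case: (x \in F); case: (x \in seq_span s); rewrite ?andbF.
rewrite sum_nat_const; have [/andP[sF /eqP sc]|] := boolP (_ && _); last by rewrite !muln0.
have sS : seq_span s \subset F by apply: seq_span_min.
by rewrite cardsDS // sc (card_flat fF).
Qed.

(** A sequence of r points in a flat of rank r spans it exactly when its span has
    [r]_q points. *)
Lemma seq_sum_bases (F : {set T}) : flat (lines P) F ->
  seq_sum (rk F) (fun s => seq_span s == F) = num_ordered_bases q (rk F).
Proof.
move=> fF; rewrite /num_ordered_bases -seq_sum_independent //; apply: eq_seq_sum => s sk.
congr nat_of_bool; apply/idP/andP => [/eqP eF|[sF /eqP sc]].
  by rewrite -{1}eF sub_flat_span eF -card_flat.
by rewrite eqEcard seq_span_min //= sc -card_flat.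
Qed.

End Bases.

(** * Adapted sequences and the double count *)

Section Blocks.
Variables (q n : nat) (P : projective_geometry q n).
Local Notation T := (point P).
Local Notation rk := (rank (lines P)).

(** For a sequence s whose length is the sum of the ranks, the blocks exhaust s, so
    that nothing remains to be tested when fs is empty. *)
Fixpoint splits_along (fs : seq {set T}) (s : seq T) : bool :=
  if fs is F :: fs' then
    (seq_span (take (rk F) s) == F) && splits_along fs' (drop (rk F) s)
  else true.

(** The starting place of a block depends only on the ranks of the earlier flats.
    This is what makes the k-th flat range over a chain when the first k-1 are
    fixed. *)
Lemma splits_along_nth (fs : seq {set T}) (s : seq T) (k : nat) :
  splits_along fs s -> k < size fs ->
  nth set0 fs k =
    seq_span (take (rk (nth set0 fs k)) (drop (\sum_(j < k) rk (nth set0 fs j)) s)).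
Proof.
elim: fs s k => [|F fs IH] s [|k] //= /andP[/eqP eF fsP].
  by rewrite big_ord0 drop0 eF.
rewrite ltnS => lt_k; rewrite {1}(IH _ _ fsP lt_k) drop_drop big_ord_recl /=.
by rewrite addnC.
Qed.

Lemma splits_along_sub (fs : seq {set T}) (s : seq T) (F : {set T}) :
  splits_along fs s -> F \in fs -> F \subset seq_span s.
Proof.
elim: fs s => [|G fs IH] s //= /andP[/eqP eG fsP].
rewrite in_cons => /orP[/eqP->|/(IH _ fsP) sF].
  rewrite -eG; apply: flat_spanS; apply/subsetP => x; rewrite !inE.
  exact: mem_take.
apply: subset_trans sF _; apply: flat_spanS; apply/subsetP => x; rewrite !inE.
exact: mem_drop.
Qed.

Lemma seq_sum_splits_along (fs : seq {set T}) : 0 < q -> all (flat (lines P)) fs ->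
  seq_sum (\sum_(F <- fs) rk F) (fun s => splits_along fs s)
    = \prod_(F <- fs) num_ordered_bases q (rk F).
Proof.
move=> q_gt0; elim: fs => [|F fs IH] /=; first by rewrite !big_nil.
case/andP=> fF /IH {}IH; rewrite !big_cons -IH -(seq_sum_bases q_gt0 fF).
rewrite -seq_sum_cat; apply: eq_seq_sum => s _.
by rewrite mulnb.
Qed.

Definition adapted (p : nat) (a : {ffun 'I_p -> {set T}}) : seq T -> bool :=
  splits_along [seq a i | i <- enum 'I_p].

Lemma adapted_nth (p : nat) (a : {ffun 'I_p -> {set T}}) (s : seq T) (k : 'I_p) :
  adapted a s ->
  a k = seq_span (take (rk (a k)) (drop (\sum_(j < p | j < k) rk (a j)) s)).
Proof.
move=> aP; have nthE (i : 'I_p) : nth set0 [seq a i | i <- enum 'I_p] i = a i.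
  by rewrite (nth_map i) ?size_enum_ord // nth_ord_enum.
have := splits_along_nth aP; move/(_ k); rewrite size_map size_enum_ord => /(_ (ltn_ord k)).
rewrite nthE (big_ord_widen p (fun j => rk (nth set0 [seq a i | i <- enum 'I_p] j))).
  by under eq_bigr do rewrite nthE.
exact: ltnW.
Qed.

Lemma adapted_span (p : nat) (a : {ffun 'I_p -> {set T}}) (s : seq T) :
  meshalkin a -> adapted a s -> seq_span s = [set: T].
Proof.
case=> _ top _ aP; apply/eqP; rewrite eqEsubset subsetT -top /=.
apply: flat_span_min (flat_seq_span s) _; apply/bigcupsP => i _.
by apply: splits_along_sub aP _; rewrite map_f ?mem_enum.
Qed.

Lemma seq_sum_adapted (p : nat) (a : {ffun 'I_p -> {set T}}) : 0 < q -> meshalkin a ->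
  seq_sum n (fun s => adapted a s) = \prod_i num_ordered_bases q (rk (a i)).
Proof.
move=> q_gt0 [fa _ ra].
have /(seq_sum_splits_along q_gt0) : all (flat (lines P)) [seq a i | i <- enum 'I_p].
  by apply/allP => F /mapP[i _ ->].
by rewrite 2!big_map 2!big_enum /= ra.
Qed.

(** The left-hand side is the number of pairs of a member of A and a sequence
    adapted to it.  Summing over the sequences first, only those that span the whole
    space contribute, by [adapted_span]. *)
Lemma adapted_double_count (p c : nat) (A : {set {ffun 'I_p -> {set T}}}) : 0 < q ->
  (forall a, a \in A -> meshalkin a) ->
  (forall s, size s = n -> #|[set a in A | adapted a s]| <= c) ->
  \sum_(a in A) \prod_i num_ordered_bases q (rk (a i)) <= c * num_ordered_bases q n.
Proof.
move=> q_gt0 mA cA.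
rewrite (eq_bigr (fun a : {ffun 'I_p -> {set T}} => seq_sum n (fun s => adapted a s)));
  last by move=> a /mA ma; rewrite seq_sum_adapted.
have fT : flat (lines P) [set: T] by apply/flatP => *; apply: subsetT.
have := seq_sum_bases q_gt0 fT; rewrite rank_geometry => <-.
rewrite -seq_sum_mull -(seq_sum_exchange (mem A)).
apply: leq_seq_sum => s /cA; have [_|spT] := eqVneq (seq_span s) [set: T].
  rewrite muln1; apply: leq_trans; rewrite -sum1dep_card [X in _ <= X]big_mkcondr /=.
  by apply: leq_sum => a _; case: (adapted a s).
move=> _; rewrite muln0 big1 // => a aA; case: (boolP (adapted a s)) => // /adapted_span.
by move/(_ (mA a aA))/eqP; rewrite (negPf spT).
Qed.

End Blocks.

(** * Bounding a family one coordinate at a time *)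

Section Branching.
Variables (p : nat) (U : finType).

Definition agreeing (M : {set {ffun 'I_p -> U}}) (a : {ffun 'I_p -> U}) (k : nat) :=
  [set b in M | [forall i : 'I_p, (i < k) ==> (b i == a i)]].

Lemma agreeingP (M : {set {ffun 'I_p -> U}}) (a b : {ffun 'I_p -> U}) (k : nat) :
  reflect (b \in M /\ forall i : 'I_p, i < k -> b i = a i) (b \in agreeing M a k).
Proof.
rewrite inE; apply: (iffP andP) => -[bM ba]; split=> //.
  by move=> i ik; have /implyP/(_ ik)/eqP := forallP ba i.
by apply/forallP => i; apply/implyP => /ba/eqP.
Qed.

(** The members of M are the leaves of a tree whose nodes at depth k are the
    possible values of the first k coordinates; a node at depth k has at most c k
    children. *)
Lemma branching_bound (M : {set {ffun 'I_p -> U}}) (c : nat -> nat) :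
  (forall (k : 'I_p) a, a \in M -> #|[set b k | b : {ffun _} in agreeing M a k]| <= c k) ->
  #|M| <= \prod_(k < p) c k.
Proof.
move=> cM; have [->|[a0 a0M]] := set_0Vmem M; first by rewrite cards0.
(* Induct from the leaves up: j counts the coordinates still to be chosen. *)
suff H j : j <= p -> forall a, a \in M ->
    #|agreeing M a (p - j)| <= \prod_(p - j <= k < p) c k.
  rewrite -(big_mkord xpredT); have := H p (leqnn p) a0 a0M; rewrite subnn.
  by apply: leq_trans; apply/subset_leq_card/subsetP => b bM; apply/agreeingP.
elim: j => [|j IH] jp a aM.
  rewrite subn0 big_geq //; apply: leq_trans (_ : #|[set a]| <= 1); last by rewrite cards1.
  apply/subset_leq_card/subsetP => b /agreeingP[_ ba]; rewrite inE; apply/eqP.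
  by apply/ffunP => i; apply: ba.
have k_lt : p - j.+1 < p by lia.
pose k := Ordinal k_lt; rewrite big_ltn //.
have -> : (p - j.+1).+1 = p - j by lia.
rewrite -sum1_card (partition_big_imset (fun b : {ffun 'I_p -> U} => b k)) /=.
apply: leq_trans (leq_mul (cM k a aM) (leqnn _)); rewrite -sum_nat_const.
apply: leq_sum => v /imsetP[b bA ->]; case/agreeingP: (bA) => bM ba.
rewrite sum1dep_card; apply: leq_trans (IH (ltnW jp) b bM).
apply/subset_leq_card/subsetP => d; rewrite !inE -andbA => /and3P[dM da /eqP db].
rewrite dM; apply/forallP => i; apply/implyP => ij.
have [ik|ki|/val_inj->] := ltngtP i k; last by rewrite db.
  by have /implyP/(_ ik)/eqP-> := forallP da i; rewrite ba.
by move: ki; rewrite /=; lia.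
Qed.

End Branching.

(** * Members of a family adapted to one sequence *)

Lemma contains_chainN_card (T : finType) (l : nat) (F C : {set {set T}}) :
  ~ contains_chain l F -> C \subset F -> chain C -> #|C| <= l.
Proof.
move=> noF CF chC; rewrite leqNgt; apply/negP => lC; apply: noF.
have /card_geqP[s [us ss sC]] := lC.
exists [set x in s]; split.
- by apply/subsetP => x; rewrite inE => /sC; apply: subsetP CF x.
- apply/forall_inP => A; rewrite inE => /sC AC; apply/forall_inP => B; rewrite inE => /sC BC.
  exact: forall_inP (forall_inP chC A AC) B BC.
- by rewrite cardsE; have /card_uniqP -> := us.
Qed.

Section Adapted.
Variables (q n : nat) (P : projective_geometry q n) (p : nat).
Local Notation T := (point P).
Local Notation rk := (rank (lines P)).
Variable M : {set {ffun 'I_p -> {set T}}}.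
Hypothesis hM : forall a, a \in M -> meshalkin a.

(** Knowing all the ranks, the blocks of s are known, and so are the flats that they
    span. *)
Lemma card_adapted_type (s : seq T) (r : 'I_p -> nat) :
  #|[set a in [set a in M | [forall i, rk (a i) == r i]] | adapted a s]| <= 1.
Proof.
apply/card_le1_eqP => a b; rewrite !inE -!andbA => /and3P[_ /forallP ra aP].
case/and3P=> _ /forallP rb bP; apply/ffunP => k.
rewrite (adapted_nth k aP) (adapted_nth k bP) (eqP (ra k)) (eqP (rb k)).
congr (seq_span (take _ (drop _ _))).
by apply: eq_bigr => i _; rewrite (eqP (ra i)) (eqP (rb i)).
Qed.

(** In the tree of [branching_bound], a node has at most l children except at the
    last level, where it has at most one since the ranks add up to n. *)
Lemma card_adapted (l : nat) (s : seq T) : 0 < p ->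
  (forall k : 'I_p, k < p.-1 ->
     ~ contains_chain l [set a k | a : {ffun 'I_p -> {set T}} in M]) ->
  #|[set a in M | adapted a s]| <= l ^ p.-1.
Proof.
move=> p_gt0 noC.
have -> : l ^ p.-1 = \prod_(k < p) (if k < p.-1 then l else 1).
  case: (p) p_gt0 => // m _; rewrite big_ord_recr /= ltnn muln1.
  rewrite (eq_bigr (fun=> l)); first by rewrite prod_nat_const card_ord.
  by move=> i _; rewrite ltn_ord.
apply: (branching_bound (c := fun k => if k < p.-1 then l else 1)) => k a.
rewrite inE => /andP[aM aP].
set A := agreeing _ _ _.
have AE b : b \in A -> b k = seq_span (take (rk (b k)) (drop (\sum_(j < p | j < k) rk (a j)) s)).
  case/agreeingP; rewrite inE => /andP[bM bP] ba.
  rewrite {1}(adapted_nth k bP); congr (seq_span (take _ (drop _ _))).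
  by apply: eq_bigr => j /ba->.
have AM b : b \in A -> b \in M by case/agreeingP; rewrite inE => /andP[].
case: ifP => kp.
  apply: (contains_chainN_card (noC k kp)).
    by apply/subsetP => _ /imsetP[b /AM bM ->]; apply: imset_f.
  apply/forall_inP => _ /imsetP[b bA ->]; apply/forall_inP => _ /imsetP[d dA ->].
  rewrite (AE b bA) (AE d dA).
  have S (u : seq T) i j : i <= j -> seq_span (take i u) \subset seq_span (take j u).
    move=> ij; apply: flat_spanS; apply/subsetP => x; rewrite !inE -(subnKC ij) takeD.
    by rewrite mem_cat => ->.
  by apply/orP; case: (leqP (rk (b k)) (rk (d k))) => [|/ltnW] /S; [left | right].
(* From here on, k is the last index. *)
have lastE (b : {ffun 'I_p -> {set T}}) : b \in A ->
    \sum_(j < p | j < k) rk (a j) + rk (b k) = n.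
  move=> bA; have [_ _ rb] := hM (AM b bA); rewrite -[RHS]rb.
  rewrite [RHS](bigD1 k) //= [RHS]addnC; congr (_ + _).
  apply: eq_big => [j|j jk]; first by have := ltn_ord j; have := ltn_ord k; rewrite -val_eqE /=; lia.
  by case/agreeingP: bA => _ ->.
apply/card_le1_eqP => _ _ /imsetP[b bA ->] /imsetP[d dA ->].
rewrite (AE b bA) (AE d dA); congr (seq_span (take _ _)).
by apply: (@addnI (\sum_(j < p | j < k) rk (a j))); rewrite !lastE.
Qed.

End Adapted.

Local Open Scope ring_scope.

(** * The weights as ratios of numbers of ordered bases *)

Lemma qintE (q m : nat) : (qint q m)%:R * (q%:R - 1) = q%:R ^+ m - 1 :> rat.
Proof.
elim: m => [|m IH]; first by rewrite qint0 mul0r expr0 subrr.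
rewrite qintS -natr1 natrM exprS mulrDl mul1r -mulrA IH; ring.
Qed.

(** The i-th factor [r]_q - [i]_q of the number of ordered bases is
    q^i (q^(r-i) - 1) / (q - 1). *)
Lemma num_ordered_basesE (q r : nat) : (0 < q)%N ->
  (num_ordered_bases q r)%:R * (q%:R - 1) ^+ r = q%:R ^+ 'C(r, 2) * qfact q r.
Proof.
move=> q_gt0; rewrite /num_ordered_bases natr_prod.
have -> : (q%:R - 1) ^+ r = \prod_(i < r) (q%:R - 1) :> rat by rewrite prodr_const card_ord.
rewrite -big_split /= -bin2_sum big_mkord expr_sum /qfact big_add1 big_mkord /=.
rewrite [X in _ = _ * X](reindex_inj rev_ord_inj) -big_split /=; apply: eq_bigr => i _.
rewrite natrB ?leq_qint ?(ltnW (ltn_ord i)) // mulrBl !qintE.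
by rewrite subnSK // mulrBr mulr1 -exprD subnKC ?(ltnW (ltn_ord i)) //; ring.
Qed.

Lemma qfact_gt0 (q m : nat) : (1 < q)%N -> 0 < qfact q m.
Proof.
move=> q_gt1; rewrite /qfact big_add1; apply: prodr_gt0 => i _.
by rewrite subr_gt0 exprn_egt1 ?ltr1n.
Qed.

Lemma meshalkin_weight_gt0 (q n p : nat) (r : 'I_p -> nat) :
  (1 < q)%N -> 0 < meshalkin_weight q n r.
Proof.
move=> q_gt1; rewrite /meshalkin_weight mulr_gt0 ?exprn_gt0 ?ltr0n ?(ltnW q_gt1) //.
by rewrite divr_gt0 ?qfact_gt0 // prodr_gt0 // => i _; rewrite qfact_gt0.
Qed.

(** Pairs of elements of a disjoint union of sets of sizes r i: either both elements
    are in the same set, or they are in different ones.  The proof compares the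
    doubles, where it amounts to expanding the square of the sum. *)
Lemma bin2_sum_s2 (p : nat) (r : 'I_p -> nat) :
  'C(\sum_i r i, 2) = (\sum_i 'C(r i, 2) + s2 r)%N.
Proof.
have dbl m : ('C(m, 2).*2 + m = m * m)%N.
  by rewrite bin2 halfK; have := odd_double_half (m * m.-1); case: m => //= m; rewrite oddM /=; case: odd; lia.
apply/double_inj/(@addIn (\sum_i r i)); rewrite dbl.
have -> : ((\sum_i 'C(r i, 2) + s2 r).*2 + \sum_i r i
    = \sum_i r i * r i + (s2 r + s2 r))%N.
  under [in RHS]eq_bigr do rewrite -dbl -addnn.
  by rewrite !big_split /=; lia.
have s2E : s2 r = (\sum_(i < p) \sum_(j < p | j < i) r i * r j)%N.
  rewrite /s2; under eq_bigr do rewrite big_mkcond; rewrite exchange_big /=.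
  apply: eq_bigr => i _; rewrite [RHS]big_mkcond; apply: eq_bigr => j _.
  by rewrite mulnC.
rewrite {1}s2E /s2 -!big_split big_distrl; apply: eq_bigr => i _ /=.
rewrite big_distrr (bigD1 i) //=; congr addn.
rewrite (bigID (fun j : 'I_p => j < i)%N) /=; congr addn; apply: eq_bigl => j.
  by rewrite -val_eqE /=; lia.
by rewrite -val_eqE /=; lia.
Qed.

(** The powers of q - 1 cancel because the r i add up to n, and the powers of q
    combine by [bin2_sum_s2]. *)
Lemma num_ordered_bases_ratio (q n p : nat) (r : 'I_p -> nat) :
  (1 < q)%N -> (\sum_i r i = n)%N ->
  (\prod_i num_ordered_bases q (r i))%:R
    = (meshalkin_weight q n r)^-1 * (num_ordered_bases q n)%:R.
Proof.
move=> q_gt1 rn; have q_gt0 := ltnW q_gt1.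
have u_neq0 : q%:R - 1 != 0 :> rat by rewrite subr_eq0 pnatr_eq1; lia.
apply: (mulIf (expf_neq0 n u_neq0)).
rewrite -mulrA num_ordered_basesE // -{1}rn expr_sum natr_prod -big_split /=.
rewrite (eq_bigr _ (fun i _ => num_ordered_basesE (r i) q_gt0)) big_split /= -expr_sum.
have := bin2_sum_s2 r; rewrite rn => ->.
rewrite /meshalkin_weight /gauss_multinomial exprD.
have qn0 m : q%:R ^+ m != 0 :> rat by rewrite expf_neq0 // pnatr_eq0; lia.
have n0 : qfact q n != 0 by rewrite gt_eqF ?qfact_gt0.
have r0 : \prod_i qfact q (r i) != 0.
  by rewrite gt_eqF // prodr_gt0 // => i _; rewrite qfact_gt0.
by field; rewrite n0 r0 qn0.
Qed.

(** * Optimal weighted sums *)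

(** Let v be the (m+1)-st largest weight.  Moving mass in c from weights that are at
    most v to the m largest ones, which are at least v, does not decrease the sum,
    and there is room for all of the mass.  If there are at most m weights, bounding
    each c i by 1 suffices. *)
Lemma weighted_sum_le_sum_largest (I : eqType) (s : seq I) (c w : I -> rat) (m : nat) :
  (forall i, i \in s -> 0 <= w i) -> (forall i, i \in s -> 0 <= c i <= 1) ->
  \sum_(i <- s) c i <= m%:R ->
  \sum_(i <- s) c i * w i <= sum_largest m [seq w i | i <- s].
Proof.
move=> w0 c01 cm; rewrite /sum_largest sort_map.
set t := sort _ s; have st : perm_eq s t by rewrite perm_sym perm_sort.
have ts : t =i s by move=> i; rewrite (perm_mem st).
rewrite -map_take big_map (perm_big _ st) /=.
rewrite (perm_big _ st) /= in cm.
have cw i : i \in t -> c i * w i <= w i.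
  by rewrite ts => it; have /andP[_ c1] := c01 i it; rewrite ler_piMl ?w0.
have [tm|mt] := leqP (size t) m.
  by rewrite take_oversize // !big_seq; apply: ler_sum.
have pw : pairwise (fun i j => w j <= w i) t.
  rewrite -sorted_pairwise; last by move=> i j k ji kj; apply: le_trans kj ji.
  by apply: sort_sorted => i j; apply: le_total.
have s1 : size (take m t) = m by rewrite size_takel // ltnW.
rewrite -(cat_take_drop m t) in pw ts cm *; rewrite !big_cat /= in cm *.
rewrite take_size_cat //.
have {mt} : (0 < size (drop m t))%N by rewrite size_drop subn_gt0.
(* The threshold v is w y, where y comes right after the m largest. *)
case: (drop m t) => // y t2 in pw ts cm * => _.
move: (take m t) s1 => t1 s1 in pw ts cm *.
rewrite pairwise_cat /= allrel_consr -andbA in pw.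
case/and4P: pw => /allP yt1 _ _ /andP[/allP yt2 _].
have yt2' i : i \in y :: t2 -> w i <= w y.
  by rewrite in_cons => /orP[/eqP->//|/yt2].
have y0 : 0 <= w y by apply: w0; rewrite -ts mem_cat mem_head orbT.
have h2 : \sum_(i <- y :: t2) c i * w i <= w y * \sum_(i <- y :: t2) c i.
  rewrite big_distrr !big_seq /=; apply: ler_sum => i it.
  have /andP[c0 _] : 0 <= c i <= 1 by apply: c01; rewrite -ts mem_cat it orbT.
  by rewrite mulrC ler_wpM2r // yt2'.
have h1 : \sum_(i <- t1) c i * w i + w y * (m%:R - \sum_(i <- t1) c i) <= \sum_(i <- t1) w i.
  have -> : m%:R = \sum_(i <- t1) 1 :> rat by rewrite big_const_seq count_predT iter_addr_0 s1.
  rewrite -sumrB big_distrr -big_split !big_seq /=; apply: ler_sum => i it.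
  have /andP[_ c1] : 0 <= c i <= 1 by apply: c01; rewrite -ts mem_cat it.
  by have := yt1 i it; nra.
have := ler_wpM2l y0 cm; nra.
Qed.

(** * The theorem *)

Section Meshalkin.
Variables (q n p : nat) (P : projective_geometry q n).
Hypothesis q_gt1 : (1 < q)%N.
Local Notation T := (point P).
Local Notation rk := (rank (lines P)).

(** Divide the double count by the number of all ordered bases. *)
Lemma lym_of_adapted (c : nat) (A : {set {ffun 'I_p -> {set T}}}) :
  (forall a, a \in A -> meshalkin a) ->
  (forall s, size s = n -> #|[set a in A | adapted a s]| <= c)%N ->
  \sum_(a in A) (meshalkin_weight q n (fun i => rk (a i)))^-1 <= c%:R.
Proof.
move=> mA cA.
have q_gt0 := ltnW q_gt1.
have B0 : 0 < (num_ordered_bases q n)%:R :> rat.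
  rewrite ltr0n prodn_gt0 // => i; rewrite subn_gt0.
  by rewrite (leqW_mono (leq_qint q_gt0)).
rewrite -(ler_pM2r B0) big_distrl /= -natrM.
have := adapted_double_count q_gt0 mA cA; rewrite -(ler_nat rat); apply: le_trans.
rewrite natr_sum; apply: ler_sum => a /mA[_ _ ra].
by rewrite (num_ordered_bases_ratio q_gt1 ra).
Qed.

Variable M : {set {ffun 'I_p -> {set T}}}.
Hypothesis hM : forall a, a \in M -> meshalkin a.

(** Group the members of M by rank type: c alpha is the number of members of type
    alpha over the weight of alpha, and it is at most 1 by [lym_of_adapted] applied
    to the members of this type. *)
Lemma card_le_sum_largest (m : nat) :
  \sum_(a in M) (meshalkin_weight q n (fun i => rk (a i)))^-1 <= m%:R ->
  (#|M|)%:R <= sum_largest m (meshalkin_weights q n p).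
Proof.
move=> Mm.
pose w (alpha : {ffun 'I_p -> 'I_n.+1}) : rat := meshalkin_weight q n (fun i => alpha i : nat).
pose ranks (a : {ffun 'I_p -> {set T}}) := [ffun i => inord (rk (a i)) : 'I_n.+1].
pose N (alpha : {ffun 'I_p -> 'I_n.+1}) := [set a in M | [forall i, rk (a i) == alpha i :> nat]].
have rk_le a i : a \in M -> (rk (a i) <= n)%N.
  by case/hM=> _ _ ra; rewrite -[X in (_ <= X)%N]ra (bigD1 i) //= leq_addr.
have ranksP a alpha : a \in M -> (ranks a == alpha) = [forall i, rk (a i) == alpha i :> nat].
  move=> aM; apply/eqP/forallP => [<- i|ra].
    by rewrite ffunE inordK // ltnS rk_le.
  by apply/ffunP => i; apply: val_inj; rewrite ffunE /= inordK ?ltnS ?rk_le //; apply/eqP.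
have ranksE a i : a \in M -> ranks a i = rk (a i) :> nat.
  by move=> aM; rewrite ffunE inordK // ltnS rk_le.
have w_gt0 alpha : 0 < w alpha by apply: meshalkin_weight_gt0.
have part (F : {ffun 'I_p -> {set T}} -> rat) :
    \sum_(a in M) F a = \sum_(alpha : {ffun 'I_p -> 'I_n.+1} | (\sum_i alpha i == n)%N)
                          \sum_(a in N alpha) F a.
  rewrite (partition_big ranks (fun alpha => (\sum_i alpha i == n)%N)) /=.
    apply: eq_bigr => alpha _; apply: eq_bigl => a; rewrite inE.
    by case: (boolP (a \in M)) => //= aM; rewrite ranksP.
  move=> a aM; have [_ _ ra] := hM aM; apply/eqP; rewrite -[RHS]ra.
  by apply: eq_bigr => i _; rewrite ranksE.
pose c alpha := (#|N alpha|)%:R / w alpha.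
have cE alpha : \sum_(a in N alpha) (meshalkin_weight q n (fun i => rk (a i)))^-1 = c alpha.
  rewrite (eq_bigr (fun=> (w alpha)^-1)) => [|a]; first by rewrite sumr_const /c -[LHS]mulr_natl.
  rewrite inE => /andP[_ /forallP ra]; congr _^-1; rewrite /w /meshalkin_weight /gauss_multinomial /s2.
  congr (_ / _ * _ ^+ _); first by apply: eq_bigr => i _; rewrite (eqP (ra i)).
  by apply: eq_bigr => i _; apply: eq_bigr => j _; rewrite (eqP (ra i)) (eqP (ra j)).
have c01 alpha : 0 <= c alpha <= 1.
  rewrite divr_ge0 ?ler0n ?(ltW (w_gt0 _)) //= -cE.
  apply: (@lym_of_adapted 1) => [a|s _]; last exact: card_adapted_type.
  by rewrite inE => /andP[/hM].
have -> : (#|M|)%:R = \sum_(alpha <- [seq alpha : {ffun 'I_p -> 'I_n.+1} <- enum {: {ffun 'I_p -> 'I_n.+1}}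
                                     | (\sum_i alpha i == n)%N]) c alpha * w alpha.
  rewrite big_filter big_enum_cond /= -sumr_const part; apply: eq_bigr => alpha _.
  by rewrite sumr_const /c divfK // gt_eqF.
apply: weighted_sum_le_sum_largest => [alpha _|alpha _|]; rewrite ?(ltW (w_gt0 _)) //.
rewrite big_filter big_enum_cond /=; apply: le_trans Mm; rewrite part.
by under [X in _ <= X]eq_bigr do rewrite cE.
Qed.

End Meshalkin.

Unset Implicit Arguments.

Theorem theorem5 (n l p q : nat) (hl : (1 <= l)%N) (hp : (2 <= p)%N)
    (hq : (2 <= q)%N) (P : projective_geometry q n)
    (M : {set {ffun 'I_p -> {set point P}}})
    (hM : forall a, a \in M -> meshalkin a)
    (hchain : forall k : 'I_p, (k < p.-1)%N ->
      ~ contains_chain l [set a k | a : {ffun 'I_p -> {set point P}} in M]) :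
  (\sum_(a in M)
      (gauss_multinomial q n (fun i => rank (lines P) (a i))
        * q%:R ^+ s2 (fun i => rank (lines P) (a i)))^-1
    <= (l ^ p.-1)%:R)
  /\
  ((#|M|)%:R <= sum_largest (l ^ p.-1) (meshalkin_weights q n p)).
Proof.
have lym : \sum_(a in M) (meshalkin_weight q n (fun i => rank (lines P) (a i)))^-1
    <= (l ^ p.-1)%:R.
  apply: lym_of_adapted => // s _.
  by apply: card_adapted hM _ _ _ hchain; apply: ltnW.
by split; last exact: card_le_sum_largest.
Qed.
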